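(* Let $\mathbf{A}$ be a subset of the monoid $\mathbf{P}_{\mathbf{PU}} = (\mathbf{P}_{\mathbf{PU}}, \circ, 1_{\mathbf{P}_{\mathbf{PU}}})$, let $$\mathbf{X} := \{ (\mathbb{R}^+, g \circ d^+) : g \in \mathbf{A} \},$$ and let $R_{\mathbf{A}}$ be the set of all right ideals $R$ of the semigroup $[\mathbf{A}]_{\mathbf{P}_{\mathbf{PU}}}$ satisfying $R \subseteq \mathbf{A}$. Write $$\overline{R} := \bigcup_{R \in R_{\mathbf{A}}} R.$$ If $1_{\mathbf{P}_{\mathbf{PU}}} \in \mathbf{A} \cap \overline{R}$, then the equality $$\overline{R}^{\,1_{\mathbf{P}_{\mathbf{PU}}}} = \mathbf{P}_{\mathbf{X}}$$ holds.
   Context: $\mathbb{R}^+ = [0,\infty)$. The ultrametric $d^+ : \mathbb{R}^+ \times \mathbb{R}^+ \to \mathbb{R}^+$ is defined by $d^+(p,q) = 0$ if $p=q$ and $d^+(p,q) = \max\{p,q\}$ otherwise. A pseudoultrametric on a nonempty set $X$ is a function $d : X \times X \to \mathbb{R}^+$ such that $d(x,x)=0$, $d(x,y)=d(y,x)$ and $d(x,y) \leqslant \max\{d(x,z), d(z,y)\}$ for all $x,y,z \in X$; then $(X,d)$ is a pseudoultrametric space. A function $f : \mathbb{R}^+ \to \mathbb{R}^+$ is pseudoultrametric-preserving if $f \circ d$ (the mapping $(x,y) \mapsto f(d(x,y))$) is a pseudoultrametric on $X$ for every pseudoultrametric space $(X,d)$. $\mathbf{P}_{\mathbf{PU}}$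 is the set of all pseudoultrametric-preserving functions; it is a monoid under function composition $\circ$, with identity $1_{\mathbf{P}_{\mathbf{PU}}} = \mathrm{Id}_{\mathbb{R}^+}$. For a class $\mathbf{X}$ of pseudoultrametric spaces, $\mathbf{P}_{\mathbf{X}}$ is the set of all functions $f : \mathbb{R}^+ \to \mathbb{R}^+$ such that $(Y, f \circ \rho) \in \mathbf{X}$ whenever $(Y,\rho) \in \mathbf{X}$. For a semigroup $(S,\ast)$ and nonempty $A \subseteq S$, $[A]_S := \{x_1 \ast x_2 \ast \cdots \ast x_n : x_1,\dots,x_n \in A,\ n \in \{1,2,3,\dots\}\}$ is the subsemigroup generated by $A$. A nonempty subset $R$ of a semigroup $(S,\ast)$ is a right ideal of $(S,\ast)$ if $r \ast s \in R$ whenever $r \in R$ and $s \in S$. If $(M,\ast,1_M)$ is a monoid and $S \subseteq M$ is either empty or a subsemigroup of $M$, then $S^{1_M} := S$ if $1_M \in S$, and $S^{1_M} := S \cup \{1_M\}$ otherwise. *)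

(* Defs.v *)
From HB Require Import structures.
From mathcomp Require Export all_boot all_order all_algebra.
From mathcomp Require Export interval_inference all_classical all_reals.

Set Implicit Arguments.
Unset Strict Implicit.
Unset Printing Implicit Defensive.

Import Order.TTheory GRing.Theory Num.Theory.

Local Open Scope classical_set_scope.
Local Open Scope ring_scope.

(* {nonneg R}, with the order and maximum inherited from R, is [0, +oo[. *)
Definition nng0 (R : realType) : {nonneg R} := 0%:nng.

Record is_pseudoultrametric (R : realType) (X : Type)
    (d : X -> X -> {nonneg R}) : Prop := IsPseudoultrametric {
  pum_refl : forall x, d x x = nng0 R;
  pum_sym : forall x y, d x y = d y x;
  pum_ultra : forall x y z, d x y <= Num.max (d x z) (d z y)
}.

Record pseudoultrametric_space (R : realType) := PseudoultrametricSpace {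
  carrier : Type;
  dist : carrier -> carrier -> {nonneg R};
  carrier_nonempty : inhabited carrier;
  dist_axiom : is_pseudoultrametric dist
}.

Definition comp_dist (R : realType) (X : Type)
    (f : {nonneg R} -> {nonneg R}) (d : X -> X -> {nonneg R}) :
  X -> X -> {nonneg R} := fun x y => f (d x y).

Definition pu_preserving (R : realType) : set ({nonneg R} -> {nonneg R}) :=
  [set f | forall S : pseudoultrametric_space R,
             is_pseudoultrametric (comp_dist f (@dist R S))].

(* A class of spaces is a plain predicate: the universe of `set` is too low
   for the type of all pseudoultrametric spaces. *)
Definition class_preserving (R : realType)
    (CX : pseudoultrametric_space R -> Prop) : set ({nonneg R} -> {nonneg R}) :=
  [set f | forall S : pseudoultrametric_space R, CX S ->
             exists fS : is_pseudoultrametric (comp_dist f (@dist R S)),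
               CX (PseudoultrametricSpace (carrier_nonempty S) fS)].

Section DPlus.
Variable R : realType.
Implicit Types p q r : {nonneg R}.

Definition dplus p q : {nonneg R} :=
  if p == q then nng0 R else Num.max p q.

Lemma dplus_pseudoultrametric : is_pseudoultrametric dplus.
Proof.
split=> [p|p q|p q r]; rewrite /dplus; first by rewrite eqxx.
  by rewrite eq_sym; case: eqVneq => // _; rewrite maxC.
have ge0 t : nng0 R <= t by rewrite -num_le /=.
case: (eqVneq p q) => [_|pq]; first by rewrite le_max ge0.
case: (eqVneq p r) => [pr|_].
  by rewrite -pr (negPf pq) le_max lexx orbT.
case: (eqVneq r q) => [->|_]; first by rewrite le_max lexx.
by rewrite ge_max !le_max !lexx !orbT.
Qed.

End DPlus.

Definition dplus_space (R : realType) : pseudoultrametric_space R :=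
  PseudoultrametricSpace (inhabits (nng0 R))
    (@dplus_pseudoultrametric R).

Definition PU (R : realType) : Type := set_type (@pu_preserving R).

Section PUMonoid.
Variable R : realType.

HB.instance Definition _ := Choice.on (PU R).

Definition PU_fun (f : PU R) : {nonneg R} -> {nonneg R} := val f.

Lemma PU_funP (f : PU R) : pu_preserving (PU_fun f).
Proof. exact: set_valP. Qed.

Lemma pu_preserving_id : @pu_preserving R idfun.
Proof. by move=> S; case: (dist_axiom S). Qed.

Lemma pu_preserving_comp (f g : {nonneg R} -> {nonneg R}) :
  pu_preserving f -> pu_preserving g -> pu_preserving (f \o g).
Proof.
by move=> fP gP S; exact: fP (PseudoultrametricSpace (carrier_nonempty S) (gP S)).
Qed.

Definition PU_one : PU R := SigSub (mem_set pu_preserving_id).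

Definition PU_mul (f g : PU R) : PU R :=
  SigSub (mem_set (pu_preserving_comp (PU_funP f) (PU_funP g))).

Lemma PU_mulA : associative PU_mul.
Proof. by move=> f g h; exact: val_inj. Qed.

Lemma PU_mul1g : left_id PU_one PU_mul.
Proof. by move=> f; exact: val_inj. Qed.

Lemma PU_mulg1 : right_id PU_one PU_mul.
Proof. by move=> f; exact: val_inj. Qed.

HB.instance Definition _ := isSemigroup.Build (PU R) PU_mulA.
HB.instance Definition _ := Semigroup_isMonoid.Build (PU R) PU_mul1g PU_mulg1.

End PUMonoid.

Definition PU_dplus_space (R : realType) (g : PU R) :
    pseudoultrametric_space R :=
  PseudoultrametricSpace (carrier_nonempty (dplus_space R))
    (PU_funP g (dplus_space R)).

Section SemigroupNotions.
Local Open Scope group_scope.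

(* All products x * s_1 * ... * s_n with n >= 0 and all factors in A. *)
Definition generated_subsemigroup (S : semigroupType) (A : set S) : set S :=
  [set z | exists x : S, exists s : seq S,
     [/\ A x, forall y, y \in s -> A y & z = foldl *%g x s]].

(* I is a right ideal of T, where T is a subsemigroup of S. *)
Definition right_ideal (S : semigroupType) (T I : set S) : Prop :=
  [/\ I !=set0, I `<=` T & forall r s, I r -> T s -> I (r * s)].

Definition adjoin_one (M : monoidType) (S : set M) : set M :=
  if 1 \in S then S else S `|` [set 1].

End SemigroupNotions.

(* Main.v *)
(** Since 1 lies in some right ideal [I] of the generated semigroup [[A]] with
    [I] included in [A], all of [[A]] lies in [I]; hence [A], [I], [[A]] and
    the union of the ideals coincide, and [A] is a submonoid. Closure of [A]
    under composition makes its elements preserve the class. Conversely, a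
    preserving [f] maps the space of [1] to that of some [h] in [A], and [f = h]
    because [d^+] takes every value: [d^+(p, 0) = p]. *)
Require Import Defs.

Import Order.TTheory GRing.Theory Num.Theory.

Local Open Scope ring_scope.
Local Open Scope classical_set_scope.

Lemma dplus0 (R : realType) (p : {nonneg R}) : dplus p (nng0 R) = p.
Proof.
rewrite /dplus; case: eqVneq => [->//|_].
by apply/max_idPl; rewrite -num_le /=.
Qed.

Lemma comp_dplus_inj (R : realType) (f g : {nonneg R} -> {nonneg R}) :
  comp_dist f (@dplus R) = comp_dist g (@dplus R) -> f = g.
Proof.
move=> fg; apply/funext => p.
by have := congr1 (fun d => d p (nng0 R)) fg; rewrite /comp_dist dplus0.
Qed.

(** Once the distances are identified, the remaining fields are proofs, equal by proof
    irrelevance. *)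
Lemma pseudoultrametric_space_eq (R : realType) (X : Type)
    (d d' : X -> X -> {nonneg R}) (i i' : inhabited X)
    (dP : is_pseudoultrametric d) (dP' : is_pseudoultrametric d') :
  d = d' -> PseudoultrametricSpace i dP = PseudoultrametricSpace i' dP'.
Proof.
move=> dd'; case: _ / dd' dP' => dP'.
by rewrite (Prop_irrelevance i i') (Prop_irrelevance dP dP').
Qed.

(** Equal records have equal distances only up to transport along some proof of [X = X]; proof
    irrelevance makes that transport trivial. *)
Lemma pseudoultrametric_space_dist_inj {R : realType} {X : Type}
    {d d' : X -> X -> {nonneg R}} {i i' : inhabited X}
    {dP : is_pseudoultrametric d} {dP' : is_pseudoultrametric d'} :
  PseudoultrametricSpace i dP = PseudoultrametricSpace i' dP' -> d = d'.
Proof.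
move=> SS'.
have [e] : exists e : X = X,
    eq_rect X (fun Y => Y -> Y -> {nonneg R}) d X e = d'.
  (* Abstracting over the whole space keeps the transport well typed while rewriting with [SS']. *)
  pose P (S : pseudoultrametric_space R) := exists e : X = carrier S,
    eq_rect X (fun Y => Y -> Y -> {nonneg R}) d (carrier S) e = @dist R S.
  suff : P (PseudoultrametricSpace i' dP') by [].
  by rewrite -SS'; exists erefl.
by rewrite (Prop_irrelevance e erefl).
Qed.

(** Each [s] equals [1 * s], and the ideal absorbs [s] on the right. *)
Lemma right_ideal1_generated {M : monoidType} {A I : set M} :
  right_ideal (generated_subsemigroup A) I -> I 1%g ->
  generated_subsemigroup A `<=` I.
Proof. by move=> [_ _ IM] I1 s As; rewrite -(mul1g s); exact: IM. Qed.

Lemma sub_generated_subsemigroup (S : semigroupType) (A : set S) :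
  A `<=` generated_subsemigroup A.
Proof. by move=> x Ax; exists x, [::]. Qed.

Lemma generated_subsemigroup_mul (S : semigroupType) (A : set S) (x y : S) :
  A x -> A y -> generated_subsemigroup A (x * y)%g.
Proof.
by move=> Ax Ay; exists x, [:: y]; split=> // z; rewrite inE => /eqP ->.
Qed.

Theorem proposition3p12 (R : realType) (A : set (PU R)) :
  let CX : pseudoultrametric_space R -> Prop :=
    fun S => exists2 g : PU R, A g & S = PU_dplus_space g in
  let RA : set (set (PU R)) :=
    [set I | right_ideal (generated_subsemigroup A) I /\ I `<=` A] in
  let Rbar : set (PU R) := \bigcup_(I in RA) I in
  (A `&` Rbar) 1%g ->
  [set PU_fun f | f in adjoin_one Rbar] = class_preserving CX.
Proof.
move=> CX RA Rbar [A1 R1].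
have [I [Iideal IA] I1] := R1.
have genI := right_ideal1_generated Iideal I1.
have RbarA : Rbar = A.
  apply/seteqP; split=> [x [J [_ JA] Jx]|x Ax]; first exact: JA.
  by exists I => //; apply/genI/sub_generated_subsemigroup.
have AM f g : A f -> A g -> A (f * g)%g.
  by move=> Af Ag; apply/IA/genI/generated_subsemigroup_mul.
rewrite /adjoin_one (mem_set R1) RbarA.
apply/seteqP; split=> [_ [f Af <-] _ [g Ag ->]|f fP].
  exists (PU_funP f (PU_dplus_space g)), (f * g)%g; first exact: AM.
  (* Both distances send [x], [y] to [f (g (dplus x y))], by conversion. *)
  exact: pseudoultrametric_space_eq.
have [|fS [h Ah fh]] := fP (PU_dplus_space 1%g); first by exists 1%g.
exists h => //; apply: comp_dplus_inj.
exact/esym/(pseudoultrametric_space_dist_inj fh).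
Qed.
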